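(* There are infinitely many elliptic curves of the form $$E_t:\ y^2=x^3-(2t)^2x+(t^2+1)^2,\qquad t\in\mathbb{Q},$$ with rank $\geq 2$; that is, there are infinitely many $t\in\mathbb{Q}$ for which $E_t$ is an elliptic curve over $\mathbb{Q}$ of rank at least $2$.
   Context: The rank of an elliptic curve $E$ over $\mathbb{Q}$ is the nonnegative integer $r$ such that $E(\mathbb{Q})\cong\mathbb{Z}^r\times E(\mathbb{Q})_{\mathrm{tors}}$. *)

(* Defs.v *)
From HB Require Import structures.
From mathcomp Require Import all_boot all_order all_algebra.
From mathcomp Require Import ring zify.
From mathcomp Require Import boolp classical_sets cardinality.

Set Implicit Arguments.
Unset Strict Implicit.
Unset Printing Implicit Defensive.

Import GRing.Theory.
Local Open Scope ring_scope.

(* ec_disc a b is the discriminant of y^2 = x^3 + a x + b. *)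
Definition ec_disc (K : fieldType) (a b : K) : K :=
  - (2 ^+ 4 * (4 * a ^+ 3 + 27 * b ^+ 2)).

Record ellipticCurve (K : fieldType) := EllipticCurve {
  ec_a : K;
  ec_b : K;
  ec_nonsingular : ec_disc ec_a ec_b != 0 }.

(* None is the point at infinity. *)
Definition on_curve (K : fieldType) (E : ellipticCurve K) : pred (option (K * K)) :=
  fun p => if p is Some (x, y) then y ^+ 2 == x ^+ 3 + ec_a E * x + ec_b E
           else true.

Record ec_point (K : fieldType) (E : ellipticCurve K) := ECPoint {
  ec_val :> option (K * K);
  ec_valP : on_curve E ec_val }.

HB.instance Definition _ (K : fieldType) (E : ellipticCurve K) :=
  [isSub for @ec_val K E].
HB.instance Definition _ (K : fieldType) (E : ellipticCurve K) :=
  [Choice of ec_point E by <:].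

Definition ec_opp_val (K : fieldType) (p : option (K * K)) : option (K * K) :=
  if p is Some (x, y) then Some (x, - y) else None.

(* Chord and tangent law. On the curve, x1 = x2 and y1 <> - y2 force
   y1 = y2 <> 0, so the slope is then that of the tangent. *)
Definition ec_slope (K : fieldType) (a x1 y1 x2 y2 : K) : K :=
  if x1 == x2 then (3 * x1 ^+ 2 + a) / (2 * y1) else (y2 - y1) / (x2 - x1).

Definition ec_add_val (K : fieldType) (a : K) (p q : option (K * K)) :
    option (K * K) :=
  match p, q with
  | None, _ => q
  | _, None => p
  | Some (x1, y1), Some (x2, y2) =>
      if (x1 == x2) && (y1 == - y2) then None else
      let l := ec_slope a x1 y1 x2 y2 in
      let x3 := l ^+ 2 - x1 - x2 in
      Some (x3, l * (x1 - x3) - y1)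
  end.

Lemma ec_two_neq0 (K : fieldType) (E : ellipticCurve K) : (2 : K) != 0.
Proof.
apply: contra (ec_nonsingular E) => /eqP h.
by rewrite /ec_disc h expr0n mul0r oppr0.
Qed.

Lemma ec_smooth (K : fieldType) (E : ellipticCurve K) (x : K) :
  x ^+ 3 + ec_a E * x + ec_b E = 0 -> 3 * x ^+ 2 + ec_a E <> 0.
Proof.
move=> h1 h2; have /eqP := ec_nonsingular E; apply; rewrite /ec_disc.
have -> : ec_a E = - (3 * x ^+ 2) by rewrite -[LHS]addr0 -(subrr (3 * x ^+ 2)) addrCA addrA h2 add0r.
have -> : ec_b E = - (x ^+ 3 + ec_a E * x).
  by apply/eqP; rewrite -addr_eq0 addrC h1.
have -> : ec_a E = - (3 * x ^+ 2) by apply/eqP; rewrite -addr_eq0 addrC h2.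
ring.
Qed.

Definition ec_poly (K : fieldType) (E : ellipticCurve K) : {poly K} :=
  'X^3 + (ec_a E)%:P * 'X + (ec_b E)%:P.

(* The line of slope l through (x1, y1) meets the curve in the three points
   of abscissae x1, x2 and l ^+ 2 - x1 - x2. *)
Lemma ec_chord (K : fieldType) (E : ellipticCurve K) (x1 y1 x2 y2 : K) :
    on_curve E (Some (x1, y1)) -> on_curve E (Some (x2, y2)) ->
    ~~ ((x1 == x2) && (y1 == - y2)) ->
  let l := ec_slope (ec_a E) x1 y1 x2 y2 in
  let x3 := l ^+ 2 - x1 - x2 in
  [/\ ec_poly E - (l%:P * ('X - x1%:P) + y1%:P) ^+ 2 =
        ('X - x1%:P) * ('X - x2%:P) * ('X - x3%:P) &
      l * (x2 - x1) + y1 = y2].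
Proof.
move=> /eqP h1 /eqP h2 h l x3.
have n2 := ec_two_neq0 E.
set a := ec_a E in h1 h2 l x3 *; set b := ec_b E in h1 h2.
have hl : l * (x2 - x1) + y1 = y2 /\
    a - 2 * l * (y1 - l * x1) =
      x1 * x2 + (x1 + x2) * (l ^+ 2 - x1 - x2).
  move: h; rewrite /l /ec_slope; case: (eqVneq x1 x2) => [e | ne] /=.
    rewrite -e in h2 *; move=> ny.
    have yy : y2 = y1.
      have : (y1 - y2) * (y1 + y2) = 0 by rewrite -subr_sqr h1 h2 subrr.
      move/eqP; rewrite mulf_eq0 subr_eq0 addr_eq0 (negPf ny) orbF.
      by move/eqP.
    have y0 : y1 != 0.
      apply: contra ny => /eqP y0; by rewrite yy y0 oppr0.
    rewrite yy subrr mulr0 add0r; split=> //.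
    field; by rewrite n2 y0.
  have d0 : x2 - x1 != 0 by rewrite subr_eq0 eq_sym.
  move=> _; split; first by field.
  have -> : a = ((y2 ^+ 2 - y1 ^+ 2) - (x2 ^+ 3 - x1 ^+ 3)) / (x2 - x1).
    rewrite h1 h2; by field.
  by field.
case: hl => hl1 hl2; split; last exact: hl1.
have hb : b = y1 ^+ 2 - x1 ^+ 3 - a * x1 by rewrite h1; ring.
have ha : a = 2 * l * (y1 - l * x1) + (x1 * x2 + (x1 + x2) * (l ^+ 2 - x1 - x2)).
  by rewrite -hl2; ring.
rewrite /ec_poly -/a -/b hb {}ha /x3.
rewrite !(rmorphD, rmorphB, rmorphM, rmorphXn, rmorphN, rmorph1, rmorph_nat) /=.
by ring.
Qed.

Lemma ec_opp_subproof (K : fieldType) (E : ellipticCurve K) (p : ec_point E) :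
  on_curve E (ec_opp_val p).
Proof. by case: p => [[[x y]|]] //=; rewrite sqrrN. Qed.

Lemma ec_add_subproof (K : fieldType) (E : ellipticCurve K) (p q : ec_point E) :
  on_curve E (ec_add_val (ec_a E) p q).
Proof.
case: p q => [[[x1 y1]|] h1] [[[x2 y2]|] h2] //.
rewrite /ec_add_val [ec_val _]/= [ec_val _]/=; case: ifPn => // h.
have [+ _] := ec_chord h1 h2 h.
set l := ec_slope _ _ _ _ _; set x3 := l ^+ 2 - _ - _.
move/(congr1 (horner^~ x3)).
rewrite /ec_poly !hornerE_comm !hornerE subrr mulr0 => /eqP.
rewrite subr_eq0 => /eqP /= ->.
by apply/eqP; ring.
Qed.

Definition ec_zero (K : fieldType) (E : ellipticCurve K) : ec_point E :=
  @ECPoint K E None isT.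
Definition ec_opp (K : fieldType) (E : ellipticCurve K) (p : ec_point E) :=
  ECPoint (ec_opp_subproof p).
Definition ec_add (K : fieldType) (E : ellipticCurve K) (p q : ec_point E) :=
  ECPoint (ec_add_subproof p q).

Lemma ec_addC (K : fieldType) (E : ellipticCurve K) : commutative (@ec_add K E).
Proof.
case=> [[[x1 y1]|] h1] [[[x2 y2]|] h2]; apply: val_inj => //=.
rewrite (eq_sym x2 x1) [y2 == _]eq_sym eqr_oppLR.
case: ifPn => // h.
have [_] := ec_chord h1 h2 h.
have -> : ec_slope (ec_a E) x2 y2 x1 y1 = ec_slope (ec_a E) x1 y1 x2 y2.
  rewrite /ec_slope (eq_sym x2 x1); move: h; case: eqVneq => [e | ne] /=.
    move=> ny; move: h2; rewrite -e /= => /eqP h2; move/eqP: h1 => h1.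
    have : (y1 - y2) * (y1 + y2) = 0 by rewrite -subr_sqr h1 h2 subrr.
    move/eqP; rewrite mulf_eq0 subr_eq0 addr_eq0 (negPf ny) orbF.
    by move/eqP ->.
  by move=> _; rewrite -[y1 - y2]opprB -[x1 - x2]opprB invrN mulrNN.
move=> e; congr (Some (_, _)); first by rewrite addrAC.
move: e; set l := ec_slope _ _ _ _ _; move: (l) => m <-; ring.
Qed.

Lemma ec_add0 (K : fieldType) (E : ellipticCurve K) :
  left_id (ec_zero E) (@ec_add K E).
Proof. by move=> p; apply: val_inj. Qed.

Lemma ec_addN (K : fieldType) (E : ellipticCurve K) :
  left_inverse (ec_zero E) (@ec_opp K E) (@ec_add K E).
Proof. by case=> [[[x y]|] h]; apply: val_inj => //=; rewrite !eqxx. Qed.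

Lemma ec_oppK (K : fieldType) (E : ellipticCurve K) : involutive (@ec_opp K E).
Proof. by case=> [[[x y]|] h]; apply: val_inj => //=; rewrite opprK. Qed.

Lemma ec_add_eq0 (K : fieldType) (E : ellipticCurve K) (p q : ec_point E) :
  ec_add p (ec_opp q) = ec_zero E -> p = q.
Proof.
case: p q => [[[x1 y1]|] h1] [[[x2 y2]|] h2] /(congr1 val) //= e; apply: val_inj => //=.
by move: e; case: ifP => // /andP[/eqP -> /eqP ->]; rewrite opprK.
Qed.

(* Associativity, by the ideal class group of K[X,Y]/(Y^2 - f):
   (u, v) stands for u + v Y. *)
Definition coord_ring (K : fieldType) (f : {poly K}) : Type :=
  ({poly K} * {poly K})%type.
HB.instance Definition _ (K : fieldType) (f : {poly K}) :=
  GRing.Zmodule.copy (coord_ring f) ({poly K} * {poly K})%type.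

Definition cr_mul (K : fieldType) (f : {poly K}) (u v : coord_ring f) :
    coord_ring f :=
  (u.1 * v.1 + f * (u.2 * v.2), u.1 * v.2 + u.2 * v.1).
Definition cr_one (K : fieldType) (f : {poly K}) : coord_ring f := (1, 0).

Lemma cr_mulA (K : fieldType) (f : {poly K}) : associative (@cr_mul K f).
Proof. by move=> [a b] [c d] [e g]; rewrite /cr_mul /=; congr (_, _); ring. Qed.
Lemma cr_mulC (K : fieldType) (f : {poly K}) : commutative (@cr_mul K f).
Proof. by move=> [a b] [c d]; rewrite /cr_mul /=; congr (_, _); ring. Qed.
Lemma cr_mul1 (K : fieldType) (f : {poly K}) : left_id (cr_one f) (@cr_mul K f).
Proof. by move=> [a b]; rewrite /cr_mul /=; congr (_, _); ring. Qed.
Lemma cr_mulD (K : fieldType) (f : {poly K}) :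
  left_distributive (@cr_mul K f) +%R.
Proof.
by move=> [a b] [c d] [e g]; rewrite /cr_mul /=; congr (_, _) => /=; ring.
Qed.
Lemma cr_one_neq0 (K : fieldType) (f : {poly K}) : cr_one f != 0.
Proof. by apply/eqP => -[] /eqP; rewrite oner_eq0. Qed.

HB.instance Definition _ (K : fieldType) (f : {poly K}) :=
  GRing.Zmodule_isComNzRing.Build (coord_ring f) (@cr_mulA K f) (@cr_mulC K f)
    (@cr_mul1 K f) (@cr_mulD K f) (@cr_one_neq0 K f).

Definition cr_norm (K : fieldType) (f : {poly K}) (u : coord_ring f) : {poly K} :=
  u.1 ^+ 2 - f * u.2 ^+ 2.

Lemma cr_normM (K : fieldType) (f : {poly K}) (u v : coord_ring f) :
  cr_norm (u * v) = cr_norm u * cr_norm v.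
Proof. case: u v => [a b] [c d]; rewrite /cr_norm /=; ring. Qed.

Lemma size_ec_poly (K : fieldType) (E : ellipticCurve K) : size (ec_poly E) = 4.
Proof.
rewrite /ec_poly -addrA size_polyDl size_polyXn //.
rewrite ltnS (leq_trans (size_polyD _ _)) // geq_max.
rewrite (leq_trans (size_polyMleq _ _)) ?size_polyX ?addn2 /=.
  by rewrite (leq_trans (size_polyC_leq1 _)).
by rewrite ltnS (leq_trans (size_polyC_leq1 _)).
Qed.

Lemma cr_norm_size (K : fieldType) (E : ellipticCurve K)
    (u : coord_ring (ec_poly E)) :
  u.2 != 0 -> (3 < size (cr_norm u))%N.
Proof.
case: u => p q /= q0; rewrite /cr_norm /=.
have f0 : ec_poly E != 0 by rewrite -size_poly_gt0 size_ec_poly.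
have sq : size (ec_poly E * q ^+ 2) = (2 * size q + 2)%N.
  rewrite size_mul ?expf_neq0 // size_ec_poly expr2 size_mul //.
  by move: q0; rewrite -size_poly_gt0; case: (size q) => // n _; lia.
have sq4 : (3 < size (ec_poly E * q ^+ 2)%R)%N.
  by move: q0; rewrite -size_poly_gt0 sq; lia.
have [->|p0] := eqVneq p 0.
  by rewrite expr0n /= sub0r size_polyN.
have sp : size (p ^+ 2) = (2 * size p).-1.
  by rewrite expr2 size_mul // mul2n addnn.
move: p0; rewrite -size_poly_gt0 => p0.
case: (ltngtP (size (p ^+ 2)) (size (ec_poly E * q ^+ 2))) => h.
- by rewrite addrC size_polyDl size_polyN.
- by rewrite size_polyDl ?size_polyN // (ltn_trans sq4).
- by move: h; rewrite sp sq; lia.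
Qed.

Lemma cr_norm_eq0 (K : fieldType) (E : ellipticCurve K)
    (u : coord_ring (ec_poly E)) : cr_norm u = 0 -> u = 0.
Proof.
move=> h; have [q0|q0] := eqVneq u.2 0; last first.
  by have := cr_norm_size q0; rewrite h size_poly0.
move: h; rewrite /cr_norm q0 expr0n /= mulr0 subr0 => /eqP.
by rewrite expf_eq0 /= => /eqP p0; case: u p0 q0 => p q /= -> ->.
Qed.

Lemma cr_mul_neq0 (K : fieldType) (E : ellipticCurve K)
    (u v : coord_ring (ec_poly E)) : u <> 0 -> v <> 0 -> u * v <> 0.
Proof.
move=> u0 v0 uv; have := cr_normM u v; rewrite uv.
rewrite {1}/cr_norm /= !expr0n /= mulr0 subr0 => /esym/eqP.
by rewrite mulf_eq0 => /orP[] /eqP /cr_norm_eq0.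
Qed.

Lemma cr_mulI (K : fieldType) (E : ellipticCurve K)
    (g u v : coord_ring (ec_poly E)) : g <> 0 -> g * u = g * v -> u = v.
Proof.
move=> g0 e; apply: contrapT => uv; apply: (@cr_mul_neq0 _ _ g (u - v)) => //.
  by move/eqP; rewrite subr_eq0 => /eqP.
by rewrite mulrBr e subrr.
Qed.

Local Open Scope classical_set_scope.

Definition is_ideal (R : comNzRingType) (I : set R) : Prop :=
  [/\ I 0, forall u v, I u -> I v -> I (u + v) & forall c u, I u -> I (c * u)].
Definition ideal_mul (R : comNzRingType) (I J : set R) : set R :=
  [set g | forall M, is_ideal M -> (forall a b, I a -> J b -> M (a * b)) -> M g].
Definition principal (R : comNzRingType) (g : R) : set R :=
  [set h | exists k, h = k * g].

Lemma ideal_mul_ideal (R : comNzRingType) (I J : set R) : is_ideal (ideal_mul I J).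
Proof.
split=> [M [] //|u v hu hv M hM h|c u hu M hM h].
  by case: (hM) => _ + _; apply; [apply: hu | apply: hv].
by case: (hM) => _ _; apply; apply: hu.
Qed.

Lemma mem_ideal_mul (R : comNzRingType) (I J : set R) (a b : R) :
  I a -> J b -> ideal_mul I J (a * b).
Proof. by move=> ha hb M _; apply. Qed.

Lemma ideal_mul_sub (R : comNzRingType) (I J M : set R) :
  is_ideal M -> (forall a b, I a -> J b -> M (a * b)) -> ideal_mul I J `<=` M.
Proof. by move=> hM h g; apply. Qed.

Lemma ideal_mulC (R : comNzRingType) : commutative (@ideal_mul R).
Proof.
move=> I J; apply/seteqP; split; apply: ideal_mul_sub;
  by [exact: ideal_mul_ideal | move=> a b ha hb; rewrite mulrC; exact: mem_ideal_mul].
Qed.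

Lemma ideal_mulA_sub (R : comNzRingType) (I J L : set R) :
  ideal_mul (ideal_mul I J) L `<=` ideal_mul I (ideal_mul J L).
Proof.
apply: ideal_mul_sub => [|u c hu hc]; first exact: ideal_mul_ideal.
apply: (hu (fun u => ideal_mul I (ideal_mul J L) (u * c))); last first.
  by move=> a b ha hb; rewrite -mulrA; do 2![apply: mem_ideal_mul => //].
have [h0 hD hM] := ideal_mul_ideal I (ideal_mul J L); split.
- by rewrite mul0r.
- by move=> v w hv hw; rewrite mulrDl; apply: hD.
- by move=> v w hv; rewrite -mulrA; apply: hM.
Qed.

Lemma ideal_mulA (R : comNzRingType) : associative (@ideal_mul R).
Proof.
move=> I J L; apply/seteqP; split; last exact: ideal_mulA_sub.
rewrite [X in X `<=` _]ideal_mulC [ideal_mul J L]ideal_mulC.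
rewrite [X in _ `<=` X]ideal_mulC [ideal_mul I J]ideal_mulC.
exact: ideal_mulA_sub.
Qed.

Lemma principal_ideal (R : comNzRingType) (g : R) : is_ideal (principal g).
Proof.
split; first by exists 0; rewrite mul0r.
  by move=> _ _ [k ->] [l ->]; exists (k + l); rewrite mulrDl.
by move=> c _ [k ->]; exists (c * k); rewrite mulrA.
Qed.

Lemma principal_mul (R : comNzRingType) (g : R) (I : set R) : is_ideal I ->
  ideal_mul (principal g) I = [set h | exists2 i, I i & h = g * i].
Proof.
move=> [i0 iD iM]; apply/seteqP; split; last first.
  by move=> _ [i hi ->]; apply: mem_ideal_mul => //; exists 1; rewrite mul1r.
apply: ideal_mul_sub; first split.
- by exists 0 => //; rewrite mulr0.
- by move=> _ _ [i hi ->] [j hj ->]; exists (i + j); [exact: iD | rewrite mulrDr].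
- by move=> c _ [i hi ->]; exists (c * i); [exact: iM | rewrite mulrCA].
- move=> _ b [k ->] hb; exists (k * b); first exact: iM.
  by rewrite mulrCA mulrA.
Qed.

Lemma principalM (R : comNzRingType) (g h : R) :
  ideal_mul (principal g) (principal h) = principal (g * h).
Proof.
rewrite principal_mul; last exact: principal_ideal.
apply/seteqP; split=> [_ [_ [k ->] ->]|_ [k ->]].
  by exists k; rewrite mulrCA.
by exists (k * h); [exists k | rewrite mulrCA].
Qed.

Lemma principal1_mul (R : comNzRingType) (I : set R) : is_ideal I ->
  ideal_mul (principal 1) I = I.
Proof.
move=> hI; rewrite principal_mul //; apply/seteqP; split.
  by move=> _ [i hi ->]; rewrite mul1r.
by move=> i hi; exists i; rewrite // mul1r.
Qed.

Lemma ideal_full (R : comNzRingType) (I : set R) :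
  is_ideal I -> I 1 -> I = principal 1.
Proof.
move=> [_ _ iM] i1; apply/seteqP; split=> [x _|x _]; first by exists x; rewrite mulr1.
by rewrite -[x]mulr1; apply: iM.
Qed.

Definition cr_poly (K : fieldType) (f p : {poly K}) : coord_ring f := (p, 0).
Definition cr_y (K : fieldType) (f : {poly K}) : coord_ring f := (0, 1).

Lemma cr_polyD (K : fieldType) (f p q : {poly K}) :
  cr_poly f (p + q) = cr_poly f p + cr_poly f q.
Proof. by congr (_, _) => /=; rewrite addr0. Qed.
Lemma cr_polyM (K : fieldType) (f p q : {poly K}) :
  cr_poly f (p * q) = cr_poly f p * cr_poly f q.
Proof. by congr (_, _) => /=; ring. Qed.
Lemma cr_polyN (K : fieldType) (f p : {poly K}) :
  cr_poly f (- p) = - cr_poly f p.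
Proof. by congr (_, _) => /=; rewrite oppr0. Qed.
Lemma cr_yy (K : fieldType) (f : {poly K}) : cr_y f * cr_y f = cr_poly f f.
Proof. by congr (_, _) => /=; ring. Qed.
Lemma cr_split (K : fieldType) (f : {poly K}) (u : coord_ring f) :
  u = cr_poly f u.1 + cr_poly f u.2 * cr_y f.
Proof. by case: u => p q; congr (_, _) => /=; ring. Qed.

Definition cr_eval (K : fieldType) (f : {poly K}) (a b : K) (u : coord_ring f) : K :=
  u.1.[a] + u.2.[a] * b.

Definition ec_ideal (K : fieldType) (E : ellipticCurve K) (p : option (K * K)) :
    set (coord_ring (ec_poly E)) :=
  if p is Some (a, b) then [set u | cr_eval a b u = 0] else principal 1.
Arguments ec_ideal {K} E p.

Lemma ec_poly_eval (K : fieldType) (E : ellipticCurve K) (a b : K) :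
  on_curve E (Some (a, b)) -> (ec_poly E).[a] = b ^+ 2.
Proof. by move/eqP=> ->; rewrite /ec_poly !hornerE. Qed.

Lemma cr_evalM (K : fieldType) (f : {poly K}) (a b : K) (u v : coord_ring f) :
  f.[a] = b ^+ 2 -> cr_eval a b (u * v) = cr_eval a b u * cr_eval a b v.
Proof.
case: u v => [p q] [r s] hf; rewrite /cr_eval /= !(hornerD, hornerM) hf; ring.
Qed.

Lemma ec_ideal_ideal (K : fieldType) (E : ellipticCurve K) (p : option (K * K)) :
  on_curve E p -> is_ideal (ec_ideal E p).
Proof.
case: p => [[a b]|] h; last exact: principal_ideal.
rewrite /ec_ideal; split=> /=.
- by rewrite /cr_eval /= horner0 mul0r addr0.
- move=> [p q] [p' q']; rewrite /cr_eval /= !hornerD => hu hv.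
  by rewrite mulrDl addrACA hu hv addr0.
- by move=> c u hu; rewrite (cr_evalM _ _ (ec_poly_eval h)) hu mulr0.
Qed.

(* On a line through the point (a, b), given by y = L(x), the ideal of (a, b)
   is generated by x - a and y - L(x). *)
Lemma ec_ideal_gen (K : fieldType) (E : ellipticCurve K) (a b : K) (L : {poly K})
    (u : coord_ring (ec_poly E)) :
  L.[a] = b -> ec_ideal E (Some (a, b)) u ->
  exists v w, u = v * cr_poly _ ('X - a%:P) + w * (cr_y _ - cr_poly _ L).
Proof.
case: u => p q hL; rewrite /ec_ideal /cr_eval /= => h.
have /factor_theorem[r hr] : root (p + q * L) a.
  by rewrite /root !hornerE hL h.
exists (cr_poly _ r), (cr_poly _ q).
rewrite -cr_polyM -hr [LHS]cr_split cr_polyD cr_polyM /=; ring.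
Qed.

Lemma mem_ec_ideal_x (K : fieldType) (E : ellipticCurve K) (a b : K) :
  ec_ideal E (Some (a, b)) (cr_poly _ ('X - a%:P)).
Proof. by rewrite /= /cr_eval /= !hornerE subrr. Qed.

Lemma mem_ec_ideal_l (K : fieldType) (E : ellipticCurve K) (a b : K) (L : {poly K}) :
  L.[a] = b -> ec_ideal E (Some (a, b)) (cr_y _ - cr_poly _ L).
Proof. by move=> h; rewrite /= /cr_eval /= !hornerE h; ring. Qed.

Lemma poly_ideal_const (K : fieldType) (J : set {poly K}) (c : K) :
  is_ideal J -> c != 0 -> J c%:P -> J 1.
Proof.
move=> [_ _ JM] c0 /(JM (c^-1)%:P).
by rewrite -polyCM mulVf.
Qed.

Lemma poly_ideal_eval (K : fieldType) (J : set {poly K}) (a : K) (w : {poly K}) :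
  is_ideal J -> J ('X - a%:P) -> J w -> J (w.[a])%:P.
Proof.
move=> [_ JD JM] hX hw.
have /factor_theorem[r hr] : root (w - (w.[a])%:P) a.
  by rewrite /root !hornerE subrr.
have -> : (w.[a])%:P = w + (- r) * ('X - a%:P) by rewrite mulNr -hr; ring.
by apply: JD => //; apply: JM.
Qed.

Lemma ec_no_double_root (K : fieldType) (E : ellipticCurve K) (a : K) (w : {poly K}) :
  ec_poly E <> ('X - a%:P) ^+ 2 * w.
Proof.
move=> h; apply: (@ec_smooth K E a).
  by have := congr1 (horner^~ a) h; rewrite /ec_poly !hornerE /= subrr expr0n !mul0r.
have := congr1 (fun p : {poly K} => p^`().[a]) h.
rewrite /ec_poly !derivE !(hornerD, hornerM, hornerN, hornerX, hornerC, hornerXn, hornerMn) /= => e.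
rewrite subrr !(mul0r, mulr0, addr0) in e; rewrite -[RHS]e; ring.

Qed.

Lemma ec_tangent_unit (K : fieldType) (E : ellipticCurve K) (J : set {poly K})
    (L w : {poly K}) (a : K) :
  is_ideal J -> J (('X - a%:P) ^+ 2) -> J (L * ('X - a%:P)) -> J (L ^+ 2) ->
  ec_poly E - L ^+ 2 = ('X - a%:P) ^+ 2 * w -> J 1.
Proof.
move=> hJ h1 h2 h3 h; have [_ JD JM] := hJ.
have [b0|b0] := eqVneq L.[a] 0.
  have /factor_theorem[m hm] : root L a by rewrite /root b0.
  case: (@ec_no_double_root K E a (w + m ^+ 2)).
  by rewrite mulrDr -h hm; ring.
have hX : J ('X - a%:P).
  have /factor_theorem[r hr] : root (L - (L.[a])%:P) a.
    by rewrite /root !hornerE subrr.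
  have -> : 'X - a%:P = (L.[a]^-1)%:P * (L * ('X - a%:P) + (- r) * ('X - a%:P) ^+ 2).
    rewrite expr2 mulrA mulNr -hr.
    transitivity ((L.[a]^-1)%:P * (L.[a])%:P * ('X - a%:P)); last ring.
    by rewrite -polyCM mulVf // mul1r.
  by apply: (JM); apply: (JD) => //; apply: (JM).
apply: (poly_ideal_const hJ (expf_neq0 2 b0)).
by have := poly_ideal_eval hJ hX h3; rewrite horner_exp.
Qed.

Lemma ec_line_unit (K : fieldType) (E : ellipticCurve K) (J : set {poly K})
    (L : {poly K}) (a1 a2 a3 : K) :
  is_ideal J ->
  J (('X - a1%:P) * ('X - a2%:P)) -> J (('X - a1%:P) * ('X - a3%:P)) ->
  J (('X - a2%:P) * ('X - a3%:P)) ->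
  J (L * ('X - a1%:P)) -> J (L * ('X - a2%:P)) -> J (L ^+ 2) ->
  ec_poly E - L ^+ 2 = ('X - a1%:P) * ('X - a2%:P) * ('X - a3%:P) -> J 1.
Proof.
move=> hJ h12 h13 h23 hL1 hL2 hLL h; have [_ JD JM] := hJ.
have [e|n12] := eqVneq a1 a2.
  have h11 : J (('X - a1%:P) ^+ 2) by rewrite expr2 {2}e.
  apply: (@ec_tangent_unit K E J L ('X - a3%:P) a1 hJ h11 hL1 hLL).
  by rewrite h -e; ring.
have [e|n13] := eqVneq a1 a3.
  have h11 : J (('X - a1%:P) ^+ 2) by rewrite expr2 {2}e.
  apply: (@ec_tangent_unit K E J L ('X - a2%:P) a1 hJ h11 hL1 hLL).
  by rewrite h -e; ring.
have [e|n23] := eqVneq a2 a3.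
  have h22 : J (('X - a2%:P) ^+ 2) by rewrite expr2 {2}e.
  apply: (@ec_tangent_unit K E J L ('X - a1%:P) a2 hJ h22 hL2 hLL).
  by rewrite h -e; ring.
have hX : J ('X - a1%:P).
  have -> : 'X - a1%:P = ((a3 - a2)^-1)%:P *
     (('X - a1%:P) * ('X - a2%:P) + (-1) * (('X - a1%:P) * ('X - a3%:P))).
    transitivity (((a3 - a2)^-1)%:P * (a3 - a2)%:P * ('X - a1%:P)).
      by rewrite -polyCM mulVf ?mul1r // subr_eq0 eq_sym.
    rewrite !polyCB; ring.
  by apply: (JM); apply: (JD) => //; apply: (JM).
apply: (@poly_ideal_const _ _ ((a1 - a2) * (a1 - a3)) hJ).
  by rewrite mulf_neq0 // subr_eq0.
by have := poly_ideal_eval hJ hX h23; rewrite !hornerE.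
Qed.

Lemma cr_poly_ideal (K : fieldType) (f : {poly K}) (J : set (coord_ring f)) :
  is_ideal J -> is_ideal [set p | J (cr_poly f p)].
Proof.
move=> [J0 JD JM]; split=> //=.
- by move=> p q hp hq; rewrite cr_polyD; apply: JD.
- by move=> p q hq; rewrite cr_polyM; apply: JM.
Qed.

Lemma colon_ideal (R : comNzRingType) (I : set R) (g : R) :
  is_ideal I -> is_ideal [set h | I (h * g)].
Proof.
move=> [I0 ID IM]; split=> /=.
- by rewrite mul0r.
- by move=> u v hu hv; rewrite mulrDl; apply: ID.
- by move=> c u hu; rewrite -mulrA; apply: IM.
Qed.

Lemma ideal_mul_principal (R : comNzRingType) (I : set R) (g : R) :
  is_ideal I -> I g -> principal g `<=` I.
Proof. by move=> [_ _ IM] ig _ [k ->]; apply: IM. Qed.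

Lemma ec_ideal_opp (K : fieldType) (E : ellipticCurve K) (a b : K) :
  on_curve E (Some (a, b)) ->
  ideal_mul (ec_ideal E (Some (a, b))) (ec_ideal E (Some (a, - b))) =
  principal (cr_poly _ ('X - a%:P)).
Proof.
move=> h; have n2 := ec_two_neq0 E.
have /factor_theorem[w hw] : root (ec_poly E - b%:P ^+ 2) a.
  by rewrite /root hornerD hornerN horner_exp hornerC (ec_poly_eval h) subrr.
set R := coord_ring (ec_poly E).
pose D : R := cr_poly _ ('X - a%:P); pose B : R := cr_poly _ b%:P.
pose Y : R := cr_y _; pose W : R := cr_poly _ w.
have hW : Y * Y - B * B = W * D.
  by rewrite /W /D -cr_polyM -hw cr_yy cr_polyD cr_polyN expr2 cr_polyM.
have hb1 : (b%:P).[a] = b by rewrite hornerC.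
have hb2 : ((- b)%:P).[a] = - b by rewrite hornerC.
have cN : cr_poly (ec_poly E) (- b)%:P = - B by rewrite polyCN cr_polyN.
have Yp := mem_ec_ideal_l E hb1; have Ym := mem_ec_ideal_l E hb2.
have X1 := mem_ec_ideal_x E a b; have X2 := mem_ec_ideal_x E a (- b).
rewrite cN opprK -/Y -/B in Yp Ym.
apply/seteqP; split.
  apply: ideal_mul_sub; first exact: principal_ideal.
  move=> u v /(ec_ideal_gen hb1)[u1 [u2 ->]] /(ec_ideal_gen hb2)[v1 [v2 ->]].
  rewrite cN -/D -/Y -/B.
  exists (u1 * v1 * D + u1 * v2 * (Y + B) + u2 * v1 * (Y - B) + u2 * v2 * W).
  transitivity ((u1 * v1 * D + u1 * v2 * (Y + B) + u2 * v1 * (Y - B)) * D +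
     u2 * v2 * (Y * Y - B * B)); first ring.
  rewrite hW; ring.
set I := ideal_mul _ _.
have hI : is_ideal I by apply: ideal_mul_ideal.
have [_ ID IM] := hI.
apply: ideal_mul_principal => //; rewrite -[cr_poly _ _]mul1r -/D.
have hJ := colon_ideal D hI; have hP := cr_poly_ideal hJ.
suff : [set p | [set h | I (h * D)] (cr_poly _ p)] (1 : {poly K}) by [].
have [b0|b0] := eqVneq b 0.
  have hX : I (D * D) by apply: mem_ideal_mul.
  apply: (@poly_ideal_const _ _ w.[a] hP).
    apply/eqP => w0.
    have /factor_theorem[m hm] : root w a by rewrite /root w0.
    case: (@ec_no_double_root K E a m).
    rewrite -[LHS](subrK (b%:P ^+ 2)) hw hm b0 polyC0; ring.
  apply: (poly_ideal_eval hP) => //=.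
  rewrite -/W -hW.
  have -> : Y * Y - B * B = (Y - B) * (Y + B) by ring.
  exact: mem_ideal_mul.
apply: (@poly_ideal_const _ _ (2 * b) hP); first by rewrite mulf_neq0.
rewrite /=.
have -> : cr_poly (ec_poly E) (2 * b)%:P = 2 * B.
  have -> : (2 * b)%:P = b%:P + b%:P by rewrite -polyCD; congr _%:P; ring.
  by rewrite cr_polyD -/B; ring.
have -> : 2 * B * D = D * (Y + B) + (-1) * ((Y - B) * D) by ring.
apply: ID; first exact: mem_ideal_mul.
by apply: IM; apply: mem_ideal_mul.
Qed.

Lemma ideal_mul3_sub (R : comNzRingType) (I J L M : set R) :
  is_ideal M -> (forall a b c, I a -> J b -> L c -> M (a * b * c)) ->
  ideal_mul (ideal_mul I J) L `<=` M.
Proof.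
move=> hM h; apply: ideal_mul_sub => // u c hu hc.
have hJ := colon_ideal c hM.
by apply: (hu _ hJ) => a b ha hb; apply: h.
Qed.

Lemma ec_ideal_line (K : fieldType) (E : ellipticCurve K) (a1 b1 a2 b2 a3 b3 : K)
    (L : {poly K}) :
  L.[a1] = b1 -> L.[a2] = b2 -> L.[a3] = b3 ->
  ec_poly E - L ^+ 2 = ('X - a1%:P) * ('X - a2%:P) * ('X - a3%:P) ->
  ideal_mul (ideal_mul (ec_ideal E (Some (a1, b1))) (ec_ideal E (Some (a2, b2))))
     (ec_ideal E (Some (a3, b3))) = principal (cr_y _ - cr_poly _ L).
Proof.
move=> h1 h2 h3 h; have n2 := ec_two_neq0 E.
set R := coord_ring (ec_poly E).
pose D1 : R := cr_poly _ ('X - a1%:P); pose D2 : R := cr_poly _ ('X - a2%:P).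
pose D3 : R := cr_poly _ ('X - a3%:P); pose C : R := cr_poly _ L.
pose Y : R := cr_y _.
have hD : D1 * D2 * D3 = (Y - C) * (Y + C).
  rewrite /D1 /D2 /D3 -!cr_polyM -h cr_polyD cr_polyN -cr_yy expr2 cr_polyM.
  by rewrite -/Y -/C; ring.
have X1 := mem_ec_ideal_x E a1 b1; have X2 := mem_ec_ideal_x E a2 b2.
have X3 := mem_ec_ideal_x E a3 b3.
have L1 := mem_ec_ideal_l E h1; have L2 := mem_ec_ideal_l E h2.
have L3 := mem_ec_ideal_l E h3.
rewrite -/Y -/C -/D1 -/D2 -/D3 in X1 X2 X3 L1 L2 L3 *.
apply/seteqP; split.
  apply: ideal_mul3_sub; first exact: principal_ideal.
  move=> u v w /(ec_ideal_gen h1)[u1 [v1 ->]] /(ec_ideal_gen h2)[u2 [v2 ->]].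
  move=> /(ec_ideal_gen h3)[u3 [v3 ->]]; rewrite -/Y -/C -/D1 -/D2 -/D3.
  exists (u1 * u2 * u3 * (Y + C) + (u1 * D1 * u2 * D2 * v3 +
    u1 * D1 * v2 * (u3 * D3 + v3 * (Y - C)) +
    v1 * (u2 * D2 + v2 * (Y - C)) * (u3 * D3 + v3 * (Y - C)))).
  rewrite [RHS]mulrDl -[_ * (Y + C) * _]mulrA [(Y + C) * _]mulrC -hD; ring.
set I := ideal_mul _ _.
have hI : is_ideal I by apply: ideal_mul_ideal.
have [_ ID IM] := hI.
have mem x y z : ec_ideal E (Some (a1, b1)) x -> ec_ideal E (Some (a2, b2)) y ->
    ec_ideal E (Some (a3, b3)) z -> I (x * y * z).
  by move=> ? ? ?; do 2![apply: mem_ideal_mul => //].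
apply: ideal_mul_principal => //; rewrite -[Y - C]mul1r.
have hJ := colon_ideal (Y - C) hI; have hP := cr_poly_ideal hJ.
have [_ JD JM] := hJ.
have halve (x : R) : I (4 * x) -> I x.
  move=> h4; have -> : x = cr_poly _ (4^-1 : K)%:P * (4 * x); last exact: IM.
  have -> : (4 : R) = cr_poly _ (4 : K)%:P.
    have -> : (4 : K)%:P = 1 + 1 + 1 + 1 :> {poly K}.
      by rewrite -!polyCD; congr _%:P; ring.
    rewrite !cr_polyD; have -> : cr_poly _ 1 = 1 :> R by [].
    ring.
  rewrite mulrA -cr_polyM -polyCM mulVf.
    by rewrite (_ : cr_poly _ _ = 1) ?mul1r.
  have -> : (4 : K) = 2 * 2 by ring.
  by rewrite mulf_neq0.
suff : [set p | [set h | I (h * (Y - C))] (cr_poly _ p)] (1 : {poly K}) by [].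
have hp : I ((Y + C) * (Y - C)) by rewrite mulrC -hD; apply: mem.
apply: (ec_line_unit hP _ _ _ _ _ _ h) => /=;
  rewrite ?expr2 ?cr_polyM -/D1 -/D2 -/D3 -/C.
- exact: mem.
- have -> : D1 * D3 * (Y - C) = D1 * (Y - C) * D3 by ring.
  exact: mem.
- have -> : D2 * D3 * (Y - C) = (Y - C) * D2 * D3 by ring.
  exact: mem.
- apply: halve.
  have -> : 4 * (C * D1 * (Y - C)) =
    (2 * D1) * ((Y + C) * (Y - C)) + (-2) * (D1 * (Y - C) * (Y - C)) by ring.
  by apply: ID; apply: IM => //; apply: mem.
- apply: halve.
  have -> : 4 * (C * D2 * (Y - C)) =
    (2 * D2) * ((Y + C) * (Y - C)) + (-2) * ((Y - C) * D2 * (Y - C)) by ring.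
  by apply: ID; apply: IM => //; apply: mem.
- apply: halve.
  have -> : 4 * (C * C * (Y - C)) =
    (3 * C - Y) * ((Y + C) * (Y - C)) + (Y - C) * (Y - C) * (Y - C) by ring.
  by apply: ID; [apply: IM | apply: mem].
Qed.

Lemma ec_ideal_oppE (K : fieldType) (E : ellipticCurve K) (P : ec_point E) :
  exists2 v, v <> 0 &
    ideal_mul (ec_ideal E P) (ec_ideal E (ec_opp P)) = principal v.
Proof.
case: P => [[[a b]|] h] /=.
  exists (cr_poly _ ('X - a%:P)); last exact: ec_ideal_opp.
  by case=> /eqP; rewrite polyXsubC_eq0.
exists 1; first by apply/eqP; rewrite oner_eq0.
by rewrite principalM mulr1.
Qed.

Lemma ec_ideal_addE (K : fieldType) (E : ellipticCurve K) (P Q : ec_point E) :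
  exists2 g, g <> 0 &
    ideal_mul (ideal_mul (ec_ideal E P) (ec_ideal E Q))
      (ec_ideal E (ec_opp (ec_add P Q))) = principal g.
Proof.
case: P => [[[x1 y1]|] h1]; last first.
  have [v v0 e] := ec_ideal_oppE Q; exists v => //=.
  by rewrite principal1_mul //; apply: ec_ideal_ideal; apply: ec_valP.
case: Q => [[[x2 y2]|] h2]; last first.
  have [v v0 e] := ec_ideal_oppE (ECPoint h1); exists v => //.
  rewrite -e /= [ideal_mul _ (principal 1)]ideal_mulC principal1_mul //.
  exact: (ec_ideal_ideal h1).
rewrite [ec_val (ec_opp _)]/= [ec_val (ECPoint h1)]/= [ec_val (ECPoint h2)]/=.
case: ifPn => h.
  have [v v0 e] := ec_ideal_oppE (ECPoint h1); exists v => //.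
  move/andP: h => [/eqP ex /eqP ey].
  have -> : Some (x2, y2) = Some (x1, - y1) by rewrite ex ey opprK.
  rewrite [ec_ideal E (ec_opp_val None)]/= ideal_mulC principal1_mul //.
  exact: ideal_mul_ideal.
have [hc hl] := ec_chord h1 h2 h.
set l := ec_slope _ _ _ _ _ in hc hl *; set x3 := l ^+ 2 - x1 - x2 in hc *.
exists (cr_y _ - cr_poly _ (l%:P * ('X - x1%:P) + y1%:P)); last first.
  apply: (ec_ideal_line _ _ _ hc).
  - by rewrite !hornerE subrr mulr0 add0r.
  - by rewrite !hornerE.
  - by rewrite !hornerE; ring.
by case=> _ /eqP; rewrite subr0 oner_eq0.
Qed.

Definition ideal_sim (R : comNzRingType) (I J : set R) : Prop :=
  exists g h, [/\ g <> 0, h <> 0 &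
    ideal_mul (principal g) I = ideal_mul (principal h) J].

Lemma ideal_sim_sym (R : comNzRingType) (I J : set R) :
  ideal_sim I J -> ideal_sim J I.
Proof. by case=> g [h [? ? ?]]; exists h, g. Qed.

Lemma ideal_sim_mul (R : comNzRingType) (I J L : set R) :
  ideal_sim I J -> ideal_sim (ideal_mul I L) (ideal_mul J L).
Proof.
by case=> g [h [g0 h0 e]]; exists g, h; split=> //; rewrite !ideal_mulA e.
Qed.

Lemma ideal_sim_trans (K : fieldType) (E : ellipticCurve K)
    (I J L : set (coord_ring (ec_poly E))) :
  ideal_sim I J -> ideal_sim J L -> ideal_sim I L.
Proof.
case=> g [h [g0 h0 e]] [g' [h' [g0' h0' e']]]; exists (g' * g), (h * h').
split; [exact: cr_mul_neq0 | exact: cr_mul_neq0 |].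
rewrite -!principalM -[LHS]ideal_mulA e ideal_mulA.
by rewrite [ideal_mul (principal g') _]ideal_mulC -!ideal_mulA e'.
Qed.

Lemma ec_ideal_sim_add (K : fieldType) (E : ellipticCurve K) (P Q : ec_point E) :
  ideal_sim (ideal_mul (ec_ideal E P) (ec_ideal E Q)) (ec_ideal E (ec_add P Q)).
Proof.
have [g g0 eg] := ec_ideal_addE P Q; have [v v0 ev] := ec_ideal_oppE (ec_add P Q).
exists v, g; split=> //; rewrite -eg -ev.
rewrite [RHS]ideal_mulC -!ideal_mulA; congr ideal_mul.
by rewrite [LHS]ideal_mulC -!ideal_mulA.
Qed.

Lemma ec_ideal_nonprincipal (K : fieldType) (E : ellipticCurve K) (P : ec_point E) :
  ideal_sim (ec_ideal E P) (principal 1) -> P = ec_zero E.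
Proof.
case: P => [[[a b]|] hP]; last by move=> _; apply: val_inj.
have hI := ec_ideal_ideal hP.
case=> g [h [g0 h0]] /=.
rewrite -/(ec_ideal E (Some (a, b))) principalM mulr1 (principal_mul _ hI) => e.
have [k hk hgk] : [set h | exists2 i, ec_ideal E (Some (a, b)) i & h = g * i] h.
  by rewrite e; exists 1; rewrite mul1r.
have gen i : ec_ideal E (Some (a, b)) i -> exists m, i = m * k.
  move=> hi; have [m hm] : principal h (g * i) by rewrite -e; exists i.
  by exists m; apply: (cr_mulI g0); rewrite hm hgk mulrCA.
have [m hm] := gen _ (mem_ec_ideal_x E a b).
have hb : (b%:P).[a] = b by rewrite hornerC.
have [m' hm'] := gen _ (mem_ec_ideal_l E hb).
have k20 : k.2 = 0.
  apply/eqP; apply: contraT => k2.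
  have := congr1 (fun u => cr_norm u) hm; rewrite cr_normM => hN.
  have nX : cr_norm (cr_poly (ec_poly E) ('X - a%:P)) = ('X - a%:P) ^+ 2.
    by rewrite /cr_norm /= expr0n /= mulr0 subr0.
  have N0 : cr_norm m * cr_norm k != 0.
    by rewrite -hN nX expf_neq0 // polyXsubC_eq0.
  have : (size (cr_norm k) <= size (('X - a%:P) ^+ 2))%N.
    rewrite -nX hN; apply: dvdp_leq => //; exact: dvdp_mull.
  rewrite expr2 size_mul ?polyXsubC_eq0 // size_XsubC /=.
  by rewrite leqNgt cr_norm_size.
have e1 : m'.2 * k.1 = 1.
  have := congr1 snd hm'; rewrite /= k20 mulr0 add0r subr0 => <-; by [].
have : (k.1).[a] = 0.
  by move: hk; rewrite /= /cr_eval k20 horner0 mul0r addr0.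
have := congr1 (horner^~ a) e1; rewrite hornerM hornerC => + k1.
by rewrite k1 mulr0 => /esym/eqP; rewrite oner_eq0.
Qed.

Lemma ec_addA (K : fieldType) (E : ellipticCurve K) : associative (@ec_add K E).
Proof.
move=> P Q R.
set S := ec_add P _; set T := ec_add _ R.
apply: ec_add_eq0; apply: ec_ideal_nonprincipal.
have hST : ideal_sim (ec_ideal E S) (ec_ideal E T).
  apply: (ideal_sim_trans (J := ideal_mul (ec_ideal E P)
            (ideal_mul (ec_ideal E Q) (ec_ideal E R)))).
    apply: ideal_sim_sym; apply: ideal_sim_trans (ec_ideal_sim_add P (ec_add Q R)).
    rewrite ideal_mulC [X in ideal_sim _ X]ideal_mulC.
    by apply: ideal_sim_mul; apply: ec_ideal_sim_add.
  rewrite ideal_mulA; apply: ideal_sim_trans (ec_ideal_sim_add (ec_add P Q) R).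
  by apply: ideal_sim_mul; apply: ec_ideal_sim_add.
apply: ideal_sim_trans (ideal_sim_sym (ec_ideal_sim_add S (ec_opp T))) _.
apply: ideal_sim_trans (ideal_sim_mul _ hST) _.
have [v v0 ->] := ec_ideal_oppE T; exists 1, v; split=> //.
  by apply/eqP; rewrite oner_eq0.
by rewrite !principalM mulrC.
Qed.

HB.instance Definition _ (K : fieldType) (E : ellipticCurve K) :=
  GRing.isZmodule.Build (ec_point E) (@ec_addA K E) (@ec_addC K E)
    (@ec_add0 K E) (@ec_addN K E).

Definition torsion_pred (A : zmodType) : {pred A} :=
  [pred x : A | `[< exists2 n : nat, (0 < n)%N & x *+ n = 0 >]].

Lemma torsion_zmod_closed (A : zmodType) : zmod_closed (@torsion_pred A).
Proof.
split=> [|x y /asboolP[m m0 hx] /asboolP[n n0 hy]].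
  by apply/asboolP; exists 1%N => //; rewrite mul0rn.
apply/asboolP; exists (m * n)%N; first by rewrite muln_gt0 m0.
by rewrite mulrnBl mulrnA hx mul0rn mulnC mulrnA hy mul0rn subr0.
Qed.
HB.instance Definition _ (A : zmodType) :=
  GRing.isZmodClosed.Build A (@torsion_pred A) (@torsion_zmod_closed A).

Record torsion (A : zmodType) := Torsion {
  torsion_val :> A;
  torsion_valP : torsion_val \in @torsion_pred A }.
HB.instance Definition _ (A : zmodType) := [isSub for @torsion_val A].
HB.instance Definition _ (A : zmodType) := [Choice of torsion A by <:].
HB.instance Definition _ (A : zmodType) :=
  [SubChoice_isSubZmodule of torsion A by <:].

Definition has_rank (A : zmodType) (r : nat) : Prop :=
  exists f : {additive A -> 'rV[int]_r * torsion A}, bijective f.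

(* For A = E(Q) there is exactly one r with has_rank A r: existence is
   Mordell's theorem, so "the rank of A is at least n" is a statement about
   every such r. The first clause keeps the predicate from holding vacuously
   when no such r exists; it follows from the second when one does. *)
Definition rank_at_least (A : zmodType) (n : nat) : Prop :=
  (exists f : {additive 'rV[int]_n -> A}, injective f) /\
  (forall r : nat, has_rank A r -> (n <= r)%N).

(* Main.v *)
From HB Require Import structures.
Require Import Defs.
From mathcomp Require Import all_boot all_order all_algebra.
From mathcomp Require Import ring zify.
From mathcomp Require Import boolp classical_sets functions cardinality.

(** Besides the evident points (0, t^2 + 1) and (2t, t^2 + 1), the curve E_t
carries R = (2, t^2 - 3), which satisfies 2R = (0, -(t^2 + 1)); so the first
evident point is always a double, and R has to replace it.  The claim is that R
and Q = (2t, t^2 + 1) are independent as soon as t is an integer congruent to 2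
modulo 15; there are infinitely many such t.

If a group has no 2-torsion and none of R, Q, R + Q is a double, then R and Q
are independent: halving a nontrivial relation mR + nQ = 0 as long as m and n
are both even ends with a relation that exhibits R, Q or R + Q as a double
([indep_of_mod2]).  Both hypotheses say that certain polynomials have no
rational root: the abscissa of a 2-torsion point is a root of the cubic, and
that of a half of a point above x is a root of the duplication quartic, which expresses that the
tangent at the half meets the curve again above x.  These are excluded by
congruences: a rational root of an integer polynomial whose leading coefficient
is prime to p reduces to a root modulo p ([rat_root_mod]).

For t = 2 modulo 3 the cubic is x^3 - x + 1, without root in F_3.  For t = 2
modulo 5 the curve becomes y^2 = x^3 - x, whose 2-torsion is rational over F_5,
so that a point is a double only if x - 1, x and x + 1 are all squares; R, Q and
R + Q reduce to points of abscissae 2, 4 and 3, and 2 and 3 are not squares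
modulo 5.  (A single prime p of good reduction cannot serve for both purposes:
E(F_p) is finite, so E(F_p) / 2 E(F_p) is trivial unless E(F_p) has 2-torsion.)

Finally an injection of Z^n into A forces n <= r whenever A is the product of
Z^r and a torsion group, which gives the second clause of
[rank_at_least]. *)

Set Implicit Arguments.
Unset Strict Implicit.
Unset Printing Implicit Defensive.

Import GRing.Theory Num.Theory.
Local Open Scope ring_scope.
Local Open Scope classical_set_scope.

(** * Rank and independence *)

Lemma clear_denominators (n : nat) (v : 'rV[rat]_n) :
  exists2 c : int, c != 0 & exists w : 'rV[int]_n, map_mx intr w = c%:~R *: v.
Proof.
exists (\prod_(i < n) denq (v 0 i)).
  by apply/prodf_neq0 => i _; rewrite denq_eq0.
exists (\row_j (numq (v 0 j) * \prod_(i < n | i != j) denq (v 0 i))).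
apply/rowP => j; rewrite !mxE [in RHS](bigD1 j) //= !intrM mulrAC.
congr (_ * _); rewrite mulrC -[X in X * _]divq_num_den divfK //.
by rewrite intr_eq0 denq_eq0.
Qed.

(** Injectivity over the integers passes to the rationals by clearing
denominators, where it bounds the rank of the matrix of [h]. *)
Lemma leq_dim_of_inj (n r : nat) (h : {additive 'rV[int]_n -> 'rV[int]_r}) :
  (forall v, h v = 0 -> v = 0) -> (n <= r)%N.
Proof.
move=> h0; pose M := \matrix_(i < n) h (delta_mx 0 i).
have hM v : h v = v *m M.
  rewrite mulmx_sum_row {1}[v]row_sum_delta raddf_sum /=.
  apply: eq_bigr => i _; rewrite rowK -[v 0 i]intz !scaler_int.
  exact: raddfMz.
have free : row_free (map_mx intr M : 'M[rat]_(n, r)).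
  apply: inj_row_free => v vM; have [c c0 [w hw]] := clear_denominators v.
  have w0 : w = 0.
    apply: h0; rewrite hM; apply/rowP => j; rewrite [RHS]mxE.
    apply: (@intr_inj rat).
    suff /rowP/(_ j) : map_mx intr (w *m M) = 0 :> 'rV[rat]_r.
      by rewrite !mxE.
    by rewrite map_mxM hw -scalemxAl vM scaler0.
  move: hw; rewrite w0 map_mx0 => /esym/eqP.
  by rewrite scaler_eq0 intr_eq0 (negPf c0) => /eqP.
by rewrite -(eqP free) rank_leq_col.
Qed.

(** An isomorphism of [A] with the product of Z^r and its torsion turns [g] into
a map from Z^n to Z^r.  Its kernel consists of vectors that [g] sends to torsion
elements, and these vanish because Z^n is torsion free. *)
Lemma rank_at_least_of_inj (A : zmodType) (n : nat)
    (g : {additive 'rV[int]_n -> A}) :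
  injective g -> rank_at_least A n.
Proof.
move=> g_inj; split=> [|r [f f_bij]]; first by exists g.
pose h : {additive 'rV[int]_n -> 'rV[int]_r} := fst \o (f \o g).
apply: (@leq_dim_of_inj n r h) => v hv0.
have /asboolP[k k0 kT] := torsion_valP (f (g v)).2.
have fk : f (g (v *+ k)) = 0.
  rewrite !raddfMn; apply: injective_projections.
    rewrite (raddfMn fst); apply: etrans (mul0rn _ k).
    by congr (_ *+ _); exact: hv0.
  by apply: val_inj; rewrite (raddfMn snd) (raddfMn val); exact: kT.
have : v *+ k = 0.
  by apply: g_inj; apply: (bij_inj f_bij); rewrite fk !raddf0.
move/rowP => vk; apply/rowP => i; have /eqP := vk i.
by rewrite mulmxnE !mxE mulrn_eq0 eqn0Ngt k0 => /eqP.
Qed.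

(** Descent on |m| + |n|: writing m = 2m' + e and n = 2n' + e' with e, e' in
{0, 1}, the relation makes eP + e'Q a double, hence e = e' = 0, and then
m'P + n'Q is 2-torsion, hence 0. *)
Lemma indep_of_mod2 (A : zmodType) (P Q : A) :
    (forall x : A, x *+ 2 = 0 -> x = 0) ->
    (forall x, x *+ 2 <> P) -> (forall x, x *+ 2 <> Q) ->
    (forall x, x *+ 2 <> P + Q) ->
  forall m n : int, P *~ m + Q *~ n = 0 -> m = 0 /\ n = 0.
Proof.
move=> tor2 hP hQ hPQ.
have parity (m : int) : exists (m' : int) (e : bool), m = m' *+ 2 + e%:R.
  by exists (m %/ 2)%Z, (m %% 2 == 1)%Z; lia.
suff H k : forall m n : int, (`|m| + `|n| <= k)%N ->
    P *~ m + Q *~ n = 0 -> m = 0 /\ n = 0.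
  by move=> m n; apply: H (leqnn _).
elim: k => [|k IH] m n; first by lia.
have [m' [e ->]] := parity m; have [n' [e' ->]] := parity n => le_k.
set S := P *~ m' + Q *~ n'.
have -> : P *~ (m' *+ 2 + e%:R) + Q *~ (n' *+ 2 + e'%:R) =
    S *+ 2 + (P *+ e + Q *+ e').
  have split (X : A) (l : int) (b : bool) :
      X *~ (l *+ 2 + b%:R) = X *~ l *+ 2 + X *+ b.
    by rewrite mulrzDr mulr2n mulrzDr -mulr2n; case: b.
  by rewrite !split addrACA -mulrnDl.
move=> S2.
have {}S2 : (- S) *+ 2 = P *+ e + Q *+ e'.
  by apply/eqP; rewrite mulNrn eq_sym -addr_eq0 addrC S2.
case: e e' S2 le_k => [] [] S2 le_k.
- by case: (hPQ (- S)).
- by case: (hP (- S)); rewrite S2 addr0.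
- by case: (hQ (- S)); rewrite S2 add0r.
have S0 : S = 0.
  by apply/eqP; rewrite -oppr_eq0; apply/eqP/tor2; rewrite S2 addr0.
have [m'0 n'0] : m' = 0 /\ n' = 0 by apply: IH S0; lia.
by rewrite m'0 n'0.
Qed.

Lemma rank_at_least2_of_mod2 (A : zmodType) (P Q : A) :
    (forall x : A, x *+ 2 = 0 -> x = 0) ->
    (forall x, x *+ 2 <> P) -> (forall x, x *+ 2 <> Q) ->
    (forall x, x *+ 2 <> P + Q) ->
  rank_at_least A 2.
Proof.
move=> tor2 hP hQ hPQ.
pose comb (v : 'rV[int]_2) := P *~ v 0 0 + Q *~ v 0 1.
have comb_add : additive comb.
  by move=> v w; rewrite /comb !mxE !mulrzBr opprD addrACA.
pose combA := GRing.isAdditive.Build _ _ _ comb_add.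
pose g : {additive 'rV[int]_2 -> A} := HB.pack comb combA.
apply: (@rank_at_least_of_inj _ _ g).
apply: raddf_inj => v /(indep_of_mod2 tor2 hP hQ hPQ)[v0 v1].
apply/rowP => i; rewrite mxE.
case: i => -[|[|i]] // li; [rewrite -[RHS]v0 | rewrite -[RHS]v1];
  by congr (v 0 _); apply: val_inj.
Qed.

(** * Rational roots modulo a prime *)

(** The denominator of a rational root divides the leading coefficient, so it is
invertible modulo p and the root can be reduced. *)
Lemma rat_root_mod (p : nat) (f : {poly int}) (u : rat) :
    prime p -> (lead_coef f)%:~R != 0 :> 'F_p -> root (map_poly intr f) u ->
  exists v : 'F_p, root (map_poly intr f) v.
Proof.
move=> p_pr lf0 fu.
have sR (R : nzRingType) : (lead_coef f)%:~R != 0 :> R ->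
    size (map_poly intr f : {poly R}) = size f.
  by move=> ?; apply: size_map_poly_id0.
set n := numq u; set d := denq u.
have f0 : f != 0 by apply: contraNneq lf0 => ->; rewrite lead_coef0.
have d0 : d%:~R != 0 :> rat by rewrite intr_eq0 denq_eq0.
set s := (size f).-1.
have ss : size f = s.+1 by rewrite /s prednK // size_poly_gt0.
(* f(n / d) = 0 cleared of denominators: a binary form in n and d. *)
have hom : \sum_(i < s.+1) f`_i * n ^+ i * d ^+ (s - i) = 0.
  apply: (@intr_inj rat); rewrite rmorph_sum /=.
  move/rootP: fu; rewrite horner_coef sR; last first.
    by rewrite intr_eq0 lead_coef_eq0.
  rewrite ss => fu.
  transitivity
    (d%:~R ^+ s * (\sum_(i < s.+1) (map_poly intr f)`_i * u ^+ i)); last first.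
    by rewrite fu mulr0.
  rewrite mulr_sumr; apply: eq_bigr => i _.
  rewrite !rmorphM !rmorphXn /= coef_map /=.
  have -> : u = n%:~R / d%:~R by rewrite divq_num_den.
  have -> : d%:~R ^+ s = d%:~R ^+ i * d%:~R ^+ (s - i) :> rat.
    by rewrite -exprD subnKC // -ltnS.
  rewrite expr_div_n; field; exact: expf_neq0.
have hom_p :
    \sum_(i < s.+1) (f`_i)%:~R * n%:~R ^+ i * d%:~R ^+ (s - i) = 0 :> 'F_p.
  transitivity (intr (\sum_(i < s.+1) f`_i * n ^+ i * d ^+ (s - i)) : 'F_p).
    by rewrite rmorph_sum /=; apply: eq_bigr => i _; rewrite !rmorphM !rmorphXn.
  by rewrite hom.
have dvdF (k : int) : (k%:~R == 0 :> 'F_p) = (p %| `|k|)%N.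
  rewrite [k in LHS]intEsign rmorphM rmorph_sign mulf_eq0 signr_eq0.
  by rewrite /= -pmulrn
    (dvdn_pcharf (pchar_Fp p_pr)).
(* If p divided d, only the leading term of the form would survive modulo p,
   so p would divide n as well. *)
have dp0 : d%:~R != 0 :> 'F_p.
  apply/negP => dp; have np : n%:~R == 0 :> 'F_p.
    move: hom_p; rewrite big_ord_recr /= subnn mulr1.
    rewrite big1 ?add0r => [|i _]; last first.
      by rewrite (eqP dp) expr0n subn_eq0 leqNgt ltn_ord mulr0.
    move/eqP; rewrite mulf_eq0 /s -lead_coefE (negPf lf0) /=.
    by rewrite expf_eq0 => /andP[].
  move: np dp; rewrite !dvdF => np dp.
  have := coprime_num_den u; rewrite /coprime => /eqP cop.
  have : (p %| gcdn `|n| `|d|)%N by rewrite dvdn_gcd np.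
  by rewrite cop dvdn1 => /eqP p1; rewrite p1 in p_pr.
exists (n%:~R / d%:~R); apply/rootP; rewrite horner_coef sR // ss.
apply: (mulfI (expf_neq0 s dp0)); rewrite mulr0 -[RHS]hom_p mulr_sumr.
apply: eq_bigr => i _; rewrite coef_map /=.
have -> : d%:~R ^+ s = d%:~R ^+ i * d%:~R ^+ (s - i) :> 'F_p.
  by rewrite -exprD subnKC // -ltnS.
rewrite expr_div_n; field; exact: expf_neq0.
Qed.

(** For a polynomial given by its coefficients, lowest degree first, the leading
coefficient is read off as the last entry. *)
Lemma Poly_rat_root_mod (p : nat) (s : seq int) (u : rat) :
    prime p -> (last 0 s)%:~R != 0 :> 'F_p ->
    horner_rec [seq c%:~R | c <- s] u = 0 ->
  exists v : 'F_p, horner_rec [seq c%:~R | c <- s] v = 0.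
Proof.
move=> p_pr s0 su.
have sK : Poly s = s :> seq int.
  apply: PolyK (0) _ _; apply: contraNneq s0 => h.
  by case: s h {su} => //= c s ->.
have map_s (R : nzRingType) :
    map_poly intr (Poly s) = Poly (map intr s) :> {poly R}.
  by apply: map_Poly_id0.
have [||v] := @rat_root_mod p (Poly s) u p_pr.
- rewrite lead_coefE sK nth_last; by case: s s0 {su sK map_s}.
- by rewrite map_s /root horner_Poly su.
by rewrite map_s /root horner_Poly => /eqP ?; exists v.
Qed.

(** * Halving points modulo a prime *)

Lemma ec_two_torsion_root (K : fieldType) (E : ellipticCurve K)
    (S : ec_point E) :
  S *+ 2 = 0 -> S = 0 \/ exists u, u ^+ 3 + ec_a E * u + ec_b E = 0.
Proof.
rewrite mulr2n; case: S => [[[u v]|] uv]; last by left; apply: val_inj.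
move/(congr1 (@ec_val K E)) => /=; rewrite eqxx /=; case: ifP => // v0 _.
right; exists u; move: (uv) => /= /eqP <-.
have /eqP : 2 * v = 0 by rewrite mulrDl mul1r [X in _ + X](eqP v0) subrr.
by rewrite mulf_eq0 (negPf (ec_two_neq0 E)) /= => /eqP->; rewrite expr0n.
Qed.

(** The duplication formula: the tangent at S = (u, v) has slope
(3 u^2 + a) / 2v, so the abscissa of 2S is a quotient of a quartic in u by
4 v^2 = 4 (u^3 + a u + b). *)
Lemma ec_double_root (K : fieldType) (E : ellipticCurve K)
    (S P : ec_point E) (x y : K) :
    ec_val P = Some (x, y) -> S *+ 2 = P ->
  exists u, u ^+ 4 - 2 * ec_a E * u ^+ 2 - 8 * ec_b E * u + ec_a E ^+ 2 =
            4 * x * (u ^+ 3 + ec_a E * u + ec_b E).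
Proof.
move=> Pxy SP; move: Pxy; rewrite -{}SP mulr2n.
case: S => [[[u v]|] uv] //=; rewrite eqxx /=; case: ifPn => // v0 [<- _].
have n2 := ec_two_neq0 E.
have {}v0 : v != 0 by apply: contra v0 => /eqP->; rewrite oppr0.
exists u; rewrite /ec_slope eqxx; move: (uv) => /= /eqP uvE.
rewrite -uvE.
have -> : ec_b E = v ^+ 2 - u ^+ 3 - ec_a E * u by rewrite uvE; ring.
by field; rewrite n2 v0.
Qed.

Lemma ec_no_two_torsion_mod (p : nat) (a b : int) (E : ellipticCurve rat) :
    prime p -> ec_a E = a%:~R -> ec_b E = b%:~R ->
    (forall v : 'F_p, v ^+ 3 + a%:~R * v + b%:~R != 0) ->
  forall S : ec_point E, S *+ 2 = 0 -> S = 0.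
Proof.
move=> p_pr aE bE noroot S /ec_two_torsion_root[//|[u]].
rewrite aE bE => u0.
have [//||v v0] := @Poly_rat_root_mod p [:: b; a; 0; 1] u p_pr.
  by rewrite -[RHS]u0 /=; ring.
by case/eqP: (noroot v); rewrite -[RHS]v0 /=; ring.
Qed.

(** The abscissa of [P] is a fraction f / e because it may fail to be an integer
(that of R + Q does); it only has to be integral at p. *)
Lemma ec_not_double_mod (p : nat) (a b f e : int) (E : ellipticCurve rat)
    (P : ec_point E) (y : rat) :
    prime p -> ec_a E = a%:~R -> ec_b E = b%:~R ->
    ec_val P = Some (f%:~R / e%:~R, y) -> e%:~R != 0 :> 'F_p ->
    (forall v : 'F_p,
       e%:~R * (v ^+ 4 - 2 * a%:~R * v ^+ 2 - 8 * b%:~R * v + a%:~R ^+ 2) !=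
       4 * f%:~R * (v ^+ 3 + a%:~R * v + b%:~R)) ->
  forall S : ec_point E, S *+ 2 <> P.
Proof.
move=> p_pr aE bE Pxy ep0 noroot S /(ec_double_root Pxy)[u].
rewrite aE bE => uE.
have e0 : e%:~R != 0 :> rat.
  by rewrite intr_eq0; apply: contraNneq ep0 => ->.
(* The coefficients of the duplication quartic of f / e, times e. *)
pose s := [:: e * a ^+ 2 - 4 * f * b; - (8 * e * b) - 4 * f * a;
              - (2 * e * a); - (4 * f); e].
have sE (F : comNzRingType) (w : F) :
    horner_rec [seq c%:~R | c <- s] w =
    e%:~R * (w ^+ 4 - 2 * a%:~R * w ^+ 2 - 8 * b%:~R * w + a%:~R ^+ 2) -
    4 * f%:~R * (w ^+ 3 + a%:~R * w + b%:~R).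
  by rewrite /=; ring.
have [||v] := @Poly_rat_root_mod p s u p_pr.
- by [].
- rewrite sE uE; by field.
by rewrite sE => /eqP; rewrite subr_eq0; apply/negP.
Qed.

Lemma ec_add_chord_x (K : fieldType) (E : ellipticCurve K) (P Q : ec_point E)
    (x1 y1 x2 y2 : K) :
    ec_val P = Some (x1, y1) -> ec_val Q = Some (x2, y2) -> x1 != x2 ->
  exists y, ec_val (P + Q) =
            Some (((y2 - y1) / (x2 - x1)) ^+ 2 - x1 - x2, y).
Proof.
case: P Q => p hp [q hq] /= -> -> x12.
by rewrite /= /ec_slope (negPf x12); eexists.
Qed.

(** * The family *)

(** With s = t^2, the discriminant is, up to a constant, the difference of the
two sides of the inequality 27 (s + 1)^4 >= 256 s^3 between the means of 1, s/3, s/3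
and s/3, with a double zero at the equality case s = 3. *)
Lemma ec_disc_familyE (K : fieldType) (t : K) :
  ec_disc (- (2 * t) ^+ 2) ((t ^+ 2 + 1) ^+ 2) =
    - (16 * (t ^+ 2 - 3) ^+ 2 * (27 * t ^+ 4 + 14 * t ^+ 2 + 3)).
Proof. by rewrite /ec_disc; ring. Qed.

Lemma ec_disc_family_neq0 (K : realFieldType) (t : K) :
  t ^+ 2 != 3 -> ec_disc (- (2 * t) ^+ 2) ((t ^+ 2 + 1) ^+ 2) != 0.
Proof.
move=> t3; rewrite ec_disc_familyE oppr_eq0 !mulf_eq0 pnatr_eq0 subr_eq0.
rewrite (negPf t3) /=.
by rewrite lt0r_neq0 // ltr_wpDl // addr_ge0 // mulr_ge0 // exprn_even_ge0.
Qed.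

(** The polynomials to be excluded depend only on t modulo 3 and modulo 5, where
the absence of roots is checked on all residues. *)
Lemma family_rank_at_least2 (k : int) (t : rat) (E : ellipticCurve rat) :
    t = (15 * k + 2)%:~R ->
    ec_a E = - (2 * t) ^+ 2 -> ec_b E = (t ^+ 2 + 1) ^+ 2 ->
  rank_at_least (ec_point E) 2.
Proof.
set m := 15 * k + 2 => tm aE bE.
have [R RE] : exists R : ec_point E, ec_val R = Some (2, t ^+ 2 - 3).
  have pR : on_curve E (Some (2, t ^+ 2 - 3)).
    by apply/eqP; rewrite aE bE; ring.
  by exists (ECPoint pR).
have [Q QE] : exists Q : ec_point E, ec_val Q = Some (2 * t, t ^+ 2 + 1).
  have pQ : on_curve E (Some (2 * t, t ^+ 2 + 1)).
    by apply/eqP; rewrite aE bE; ring.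
  by exists (ECPoint pQ).
pose a : int := - (2 * m) ^+ 2; pose b : int := (m ^+ 2 + 1) ^+ 2.
have aK (K : comNzRingType) : a%:~R = - (2 * m%:~R) ^+ 2 :> K.
  by rewrite /a; move: (m) => l; ring.
have bK (K : comNzRingType) : b%:~R = (m%:~R ^+ 2 + 1) ^+ 2 :> K.
  by rewrite /b; move: (m) => l; ring.
have {}aE : ec_a E = a%:~R by rewrite aE tm aK.
have {}bE : ec_b E = b%:~R by rewrite bE tm bK.
have x12 : 2 != 2 * t.
  have -> : 2 * t = (2 * m)%:~R by rewrite rmorphM tm.
  by rewrite -[2]/(2%:~R) eqr_int; lia.
have mK (K : comNzRingType) : m%:~R = 15 * k%:~R + 2 :> K.
  by rewrite /m; ring.
have m3 : m%:~R = 2 :> 'F_3.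
  by rewrite mK (_ : 15 = 0) ?mul0r ?add0r //; apply/eqP.
have m5 : m%:~R = 2 :> 'F_5.
  by rewrite mK (_ : 15 = 0) ?mul0r ?add0r //; apply/eqP.
(* The cubic is v^3 - v + 1 in F_3. *)
have tor2 (S : ec_point E) : S *+ 2 = 0 -> S = 0.
  apply: (@ec_no_two_torsion_mod 3 a b E) => // v.
  by rewrite aK bK m3; case: v => -[|[|[|v]]] lv.
(* In F_5 the curve is y^2 = x^3 - x, and R, Q, R + Q have abscissae 2, 4, 3. *)
have hR (S : ec_point E) : S *+ 2 <> R.
  apply: (@ec_not_double_mod 5 a b 2 1 E R (t ^+ 2 - 3)) => //.
  by move=> v; rewrite aK bK m5; case: v => -[|[|[|[|[|v]]]]] lv.
have hQ (S : ec_point E) : S *+ 2 <> Q.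
  apply: (@ec_not_double_mod 5 a b (2 * m) 1 E Q (t ^+ 2 + 1)) => //.
    by rewrite QE divr1 tm rmorphM.
  by move=> v; rewrite aK bK rmorphM /= m5; case: v => -[|[|[|[|[|v]]]]] lv.
have hRQ (S : ec_point E) : S *+ 2 <> R + Q.
  (* x(R + Q) = 4 / (t - 1)^2 - 2 - 2t *)
  have [y RQE] := ec_add_chord_x RE QE x12.
  pose e : int := (m - 1) ^+ 2; pose f : int := 4 - (2 + 2 * m) * (m - 1) ^+ 2.
  have eK (K : comNzRingType) : e%:~R = (m%:~R - 1) ^+ 2 :> K.
    by rewrite /e; move: (m) => l; ring.
  have fK (K : comNzRingType) :
      f%:~R = 4 - (2 + 2 * m%:~R) * (m%:~R - 1) ^+ 2 :> K.
    by rewrite /f; move: (m) => l; ring.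
  apply: (@ec_not_double_mod 5 a b f e E (R + Q) y) => //.
  - rewrite RQE eK fK -tm; congr (Some (_, _)).
    have d0 : 2 * t - 2 != 0 by rewrite subr_eq0 eq_sym.
    have t1 : t - 1 != 0.
      apply: contraNneq d0 => t1.
      by rewrite -[2 in X in _ - X]mulr1 -mulrBr t1 mulr0.
    move: d0 t1; move: (t) => z d0 t1.
    by field; rewrite t1.
  - by rewrite eK m5.
  by move=> v; rewrite aK bK fK eK m5; case: v => -[|[|[|[|[|v]]]]] lv.
exact: rank_at_least2_of_mod2 tor2 hR hQ hRQ.
Qed.

Theorem theorem7p1 :
  infinite_set [set t : rat |
    exists Et_nonsingular : ec_disc (- (2 * t) ^+ 2) ((t ^+ 2 + 1) ^+ 2) != 0,
      rank_at_least (ec_point (EllipticCurve Et_nonsingular)) 2].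
Proof.
apply/infiniteP/pcard_leP/injfunPex.
pose tk (k : nat) : rat := (15 * k%:Z + 2)%:~R.
exists tk => [k _|k l _ _ /intr_inj]; last by lia.
have t3 : tk k ^+ 2 != 3.
  by rewrite -rmorphXn -[3]/(3%:~R) eqr_int; nia.
exists (ec_disc_family_neq0 t3).
exact: (@family_rank_at_least2 k%:Z (tk k)).
Qed.
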